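(* Let $G$ be any Bayesian network on three discrete random variables $X_1,X_2,X_3$ with arbitrary positive numbers of levels $d_1,d_2,d_3$. Then the local Markov ideal $I_{\mathrm{local}(G)}\subset\mathbb{R}[D]$ is prime, and it has a quadratic Gröbner basis (a Gröbner basis, for some term order, consisting of quadratic polynomials; the empty set when the ideal is zero).
   Context: Independence ideals. Let $X_1,\dots,X_n$ be discrete random variables, $X_i$ taking values in $[d_i]=\{1,\dots,d_i\}$, and $D=[d_1]\times\cdots\times[d_n]$. $\mathbb{R}[D]$ is the polynomial ring over $\mathbb{R}$ in the unknowns $p_{u_1\cdots u_n}$, $(u_1,\dots,u_n)\in D$. For pairwise disjoint $A,B,C\subseteq\{X_1,\dots,X_n\}$ and tuples of values $a,b,c$ of the variables in $A,B,C$, let $p_{a,b,c,+}$ be the sum of all $p_u$ over $u\in D$ whose coordinates in $A,B,C$ are $a,b,c$. The ideal $I_{A\perp B\mid C}$ is generated by all $p_{a,b,c,+}\,p_{a',b',c,+}-p_{a,b',c,+}\,p_{a',b,c,+}$ (it is $0$ if $A$ or $B$ is empty). The ideal $I_{\mathcal M}$ of a set $\mathcal M$ of statements $A\perp B\mid C$ is the sum of the corresponding ideals. Bayesian networks. A Bayesian network is an acyclic directed graph $G$ with vertices $X_1,\dots,X_n$. Let $\mathrm{pa}(X_i)$ be the set of parents of $X_i$ and $\mathrm{nd}(X_i)$ the set of nondescendents of $X_i$, i.e. vertices $X_j\ne X_i$, not parents of $X_i$, such that there is no directed path from $X_i$ to $X_j$. Then $\mathrm{local}(G)=\{X_i\perp\mathrm{nd}(X_i)\mid\mathrm{pa}(X_i):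 i=1,\dots,n\}$, and $I_{\mathrm{local}(G)}$ is the ideal of this set of statements. *)

(* Defs.v *)
From HB Require Import structures.
From mathcomp Require Export all_boot all_order all_algebra.
From mathcomp Require Export ring_quotient.
From mathcomp Require Export boolp classical_sets reals.
From mathcomp Require Export mpoly.

Set Implicit Arguments.
Unset Strict Implicit.
Unset Printing Implicit Defensive.

Import GRing.Theory.
Local Open Scope classical_set_scope.
Local Open Scope ring_scope.

Definition ideal_gen (T : comNzRingType) (S : set T) : set T :=
  [set f | exists (k : nat) (c g : 'I_k -> T),
     (forall i, S (g i)) /\ f = \sum_(i < k) c i * g i].

(* [idealr_closed I] says that I is an ideal not containing 1. *)
Definition prime_ideal (T : comNzRingType) (I : set T) : Prop :=
  idealr_closed (mem I) /\ prime_idealr_closed (mem I).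

Record term_order (N : nat) (le : rel 'X_{1..N}) : Prop := TermOrder {
  term_order_anti : antisymmetric le;
  term_order_trans : transitive le;
  term_order_total : total le;
  term_order_zero : forall m, le 0%MM m;
  term_order_add : forall m m1 m2, le m1 m2 -> le (m + m1)%MM (m + m2)%MM
}.

(* The library's [mlead] is tied to one fixed order, whence a relation
   parameterized by the order; it never holds when f = 0. *)
Definition is_lead (R : nzRingType) (N : nat) (le : rel 'X_{1..N})
    (f : {mpoly R[N]}) (m : 'X_{1..N}) : Prop :=
  m \in msupp f /\ (forall m', m' \in msupp f -> le m' m).

Definition initial_ideal (R : comNzRingType) (N : nat) (le : rel 'X_{1..N})
    (S : set {mpoly R[N]}) : set {mpoly R[N]} :=
  ideal_gen [set h | exists f m, [/\ S f, is_lead le f m & h = 'X_[m]]].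

Definition groebner_basis (R : comNzRingType) (N : nat) (le : rel 'X_{1..N})
    (gs : seq {mpoly R[N]}) (I : set {mpoly R[N]}) : Prop :=
  (forall g, g \in gs -> I g) /\
  initial_ideal le I = initial_ideal le [set g | g \in gs].

(* [msize] is one plus the total degree, and 0 for the zero polynomial. *)
Definition quadratic (R : nzRingType) (N : nat) (f : {mpoly R[N]}) : Prop :=
  msize f = 3%N.

Section IndependenceIdeals.

Variables (R : comNzRingType) (n : nat) (d : 'I_n -> nat).

(* The levels of the i-th variable are 0, ..., d i - 1 rather than
   1, ..., d i. *)
Definition outcome := {dffun forall i : 'I_n, 'I_(d i)}.

Definition values (A : {set 'I_n}) :=
  {dffun forall i : {i : 'I_n | i \in A}, 'I_(d (val i))}.

Definition agrees (A : {set 'I_n}) (u : outcome) (a : values A) : bool :=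
  [forall i, u (val i) == a i].

Definition prob_ring := {mpoly R[#|outcome|]}.

Definition unknown (u : outcome) : prob_ring := 'X_(enum_rank u).

Definition marginal (A B C : {set 'I_n})
    (a : values A) (b : values B) (c : values C) : prob_ring :=
  \sum_(u : outcome | [&& agrees u a, agrees u b & agrees u c]) unknown u.

(* (A, B, C) stands for "A independent of B given C"; the three sets are meant
   to be pairwise disjoint. *)
Definition ci_statement : Type :=
  ({set 'I_n} * {set 'I_n} * {set 'I_n})%type.

(* If A or B is empty, then a = a' or b = b', all the generators vanish and the
   ideal is 0. *)
Definition ci_ideal (s : ci_statement) : set prob_ring :=
  let: (A, B, C) := s in
  ideal_gen [set f : prob_ring |
    exists (a a' : values A) (b b' : values B) (c : values C),
      f = marginal a b c * marginal a' b' c - marginal a b' c * marginal a' b c].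

Definition ci_model_ideal (M : {set ci_statement}) : set prob_ring :=
  [set f | exists g : ci_statement -> prob_ring,
     (forall s, s \in M -> ci_ideal s (g s)) /\ f = \sum_(s in M) g s].

End IndependenceIdeals.

Section BayesianNetworks.

Variables (n : nat) (G : rel 'I_n).

Definition bayesian_network : Prop :=
  forall p : seq 'I_n, p != [::] -> ~~ cycle G p.

Definition parents (i : 'I_n) : {set 'I_n} := [set j | G j i]%SET.

Definition nondescendents (i : 'I_n) : {set 'I_n} :=
  [set j | [&& j != i, j \notin parents i & ~~ connect G i j]]%SET.

Definition local_markov : {set ci_statement n} :=
  [set ([set i], nondescendents i, parents i) | i : 'I_n]%SET.

End BayesianNetworks.

Definition local_markov_ideal (R : comNzRingType) (n : nat) (d : 'I_n -> nat)
    (G : rel 'I_n) : set (prob_ring R d) :=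
  ci_model_ideal (local_markov G).

Arguments local_markov_ideal R {n} d G.

(* Main.v *)
From HB Require Import structures.
Require Import Defs.
From mathcomp Require Import finset zify ring.

Set Implicit Arguments.
Unset Strict Implicit.
Unset Printing Implicit Defensive.

Import Order.TTheory GRing.Theory.
Local Open Scope ring_scope.

(** Every ideal in question is the kernel of a ring homomorphism into a
polynomial ring, hence prime, and one description covers all graphs on three
vertices.

The vertices are split into a set C of conditioning variables, a set E of
variables that are summed out, and blocks, which are to be mutually independent
given C.  Call an outcome a pivot if its coordinates in E are the first levels;
the marginals over E then correspond to the pivots, t giving the linear form
L_t, the sum of the unknowns p_u where u agrees with t outside E.  The model is
parametrized by sending L_t to the product, over the labels of the blocks, of a
free parameter indexed by the label and by the values of t on C and on the block;
the unknowns that are not pivots have parameters of their own ([param]).  After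
the triangular substitution that turns L_t into p_t ([shear]), this is a monomial
map.

Order the values within each block.  For pivots s, t with the same C-part, let
s /\ t and s \/ t be the blockwise minimum and maximum.  The quadrics
L_s L_t - L_(s /\ t) L_(s \/ t), for s and t incomparable, lie in the kernel.  In
the order that compares weights first, the weight of a pivot being a constant
minus the square of its height, p_s p_t is the leading monomial.  A monomial
divisible by no such p_s p_t is a chain: its pivots with a given C-part are
totally ordered.  Two chains with the same image under the monomial map are
equal, because they share a variable ([chain_common], [chain_uniq]), and any other
monomial can be lowered within its fibre by a swap; so chains are the least
elements of the fibres ([chain_minimal]).  The leading monomial of a polynomial
in the kernel is not least in its fibre, since its image has to cancel, so it is
divisible by the leading monomial of a quadric.  By division, the quadrics
generate the kernel and are a Groebner basis of it ([groebner_criterion]).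

The model ideal lies in the kernel because a minor of marginals is a sum of
swaps of whole blocks ([param_minor]), and it contains the quadrics because such
a swap can be made one block at a time ([swap_labels_form]).  Finally C, E and
the blocks are chosen for each graph: everything in C for a complete graph,
singletons for the edgeless graph, two blocks for an isolated vertex and an
edge, C the middle vertex for a chain or a fork, E the common child for a
collider. *)

Definition prime_quadratic (F : fieldType) (N : nat) (I : set {mpoly F[N]}) : Prop :=
  prime_ideal I /\ exists (le : rel 'X_{1..N}) (gs : seq {mpoly F[N]}),
    [/\ term_order le, groebner_basis le gs I & forall g, g \in gs -> quadratic g].

Definition strict (T : eqType) (le : rel T) : rel T :=
  fun x y => le x y && (x != y).

(** * Term orders by weight *)

Definition weight N (w : 'I_N -> nat) (m : 'X_{1..N}) : nat :=
  (\sum_i m i * w i)%N.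

Definition weight_le N (w : 'I_N -> nat) : rel 'X_{1..N} :=
  fun m1 m2 => (weight w m1 < weight w m2)%N ||
    ((weight w m1 == weight w m2) && (m1 <= m2)%O).

Section WeightOrder.
Variables (N : nat) (w : 'I_N -> nat).

Lemma weight0 : weight w 0%MM = 0%N.
Proof. by rewrite /weight big1 // => i _; rewrite mnm0E. Qed.

Lemma weightD m1 m2 : weight w (m1 + m2)%MM = (weight w m1 + weight w m2)%N.
Proof.
by rewrite /weight -big_split; apply: eq_bigr => i _; rewrite mnmDE mulnDl.
Qed.

Lemma weightU i : weight w U_(i)%MM = w i.
Proof.
rewrite /weight (bigD1 i) //= big1 ?addn0 ?mnm1E ?eqxx ?mul1n // => j ne_ji.
by rewrite mnm1E eq_sym (negbTE ne_ji).
Qed.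

Lemma weight_leW m1 m2 : weight_le w m1 m2 -> (weight w m1 <= weight w m2)%N.
Proof. by case/orP => [/ltnW //|/andP [/eqP -> _]]. Qed.

Lemma weight_le_order : term_order (weight_le w).
Proof.
split=> [m1 m2|m2 m1 m3|m1 m2|m|m m1 m2]; rewrite /weight_le.
- case: (ltngtP (weight w m1) (weight w m2)) => //= _.
  by move=> /le_anti.
- case: (ltngtP (weight w m1) (weight w m2)) => //= [lt12 _|-> le12].
    case: (ltngtP (weight w m2) (weight w m3)) => //= [lt23 _|<- _].
      by rewrite (ltn_trans lt12 lt23).
    by rewrite lt12.
  case: (ltngtP (weight w m2) (weight w m3)) => //= _ le23.
  exact: le_trans le12 le23.
- by case: ltngtP => //= _; exact: le_total.
- by rewrite weight0; case: ltngtP => //= _; exact: le0m.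
- by rewrite !weightD ltn_add2l eqn_add2l lemc_add2r.
Qed.

(** The weights are natural numbers and the tie-breaking order is well founded,
so this is a lexicographic product of well-founded orders. *)
Lemma weight_le_wf : well_founded (strict (weight_le w)).
Proof.
suff acc k : forall m, (weight w m < k)%N -> Acc (strict (weight_le w)) m.
  by move=> m; exact: acc (ltnSn _).
elim: k => [//|k IHk] m; rewrite ltnS.
elim/(well_founded_ind (@ltom_wf N)): m => m IHm le_mk.
constructor=> m' /andP [/orP [lt_m' _|/andP [/eqP eq_w le_m'] ne_m']].
  by apply: IHk; exact: leq_trans lt_m' le_mk.
by apply: IHm; rewrite ?eq_w // lt_neqAle ne_m' le_m'.
Qed.

End WeightOrder.

(** * Leading monomials and a Groebner criterion *)

Section Leads.
Variables (K : fieldType) (N : nat) (le : rel 'X_{1..N}).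
Hypothesis ole : term_order le.

Lemma term_order_refl m : le m m.
Proof. by have := term_order_total ole m m; rewrite orbb. Qed.

Lemma is_lead_exists (f : {mpoly K[N]}) : f != 0 -> exists m, is_lead le f m.
Proof.
rewrite -msupp_eq0 /is_lead; elim: (msupp f : seq _) => [//|m s IHs] _.
have [->|/IHs [m' [m's max_m']]] := eqVneq s [::].
  exists m; split=> [|m']; rewrite inE ?eqxx // => /eqP ->.
  exact: term_order_refl.
have /orP [le_mm'|le_m'm] := term_order_total ole m m'.
  exists m'; split=> [|m'']; rewrite inE ?m's ?orbT // => /predU1P [-> //|].
  exact: max_m'.
exists m; split=> [|m'']; rewrite inE ?eqxx // => /predU1P [->|/max_m' le_m''].
  exact: term_order_refl.
exact: term_order_trans ole _ _ _ le_m'' le_m'm.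
Qed.

Lemma is_lead_uniq (f : {mpoly K[N]}) m1 m2 :
  is_lead le f m1 -> is_lead le f m2 -> m1 = m2.
Proof.
move=> [s1 max1] [s2 max2]; apply: (term_order_anti ole).
by rewrite max1 ?max2.
Qed.

End Leads.

Definition is_ideal (T : comNzRingType) (I : set T) : Prop :=
  I 0 /\ forall a u v, I u -> I v -> I (a * u + v).

Section Ideals.
Variable T : comNzRingType.
Implicit Types (I S : set T).

Lemma is_idealD I u v : is_ideal I -> I u -> I v -> I (u + v).
Proof. by move=> [_ cl] Iu Iv; rewrite -[u]mul1r; exact: cl. Qed.

Lemma is_idealM I a u : is_ideal I -> I u -> I (a * u).
Proof. by move=> [I0 cl] Iu; rewrite -[_ * _]addr0; exact: cl. Qed.

Lemma is_ideal_sum I (J : Type) (r : seq J) (P : pred J) (F : J -> T) :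
  is_ideal I -> (forall j, P j -> I (F j)) -> I (\sum_(j <- r | P j) F j).
Proof.
move=> idI IF; elim/big_rec: _ => [|j x Pj Ix]; first by case: idI.
by apply: is_idealD => //; exact: IF.
Qed.

Lemma is_ideal_gen S : is_ideal (ideal_gen S).
Proof.
split=> [|a u v [k [c [g [Sg ->]]]] [l [c' [g' [Sg' ->]]]]].
  by exists 0%N, (fun=> 0), (fun=> 0); split=> [[]//|]; rewrite big_ord0.
exists (k + l)%N,
  (fun i => match split i with inl j => a * c j | inr j => c' j end),
  (fun i => match split i with inl j => g j | inr j => g' j end).
split=> [i|]; first by case: (split i).
rewrite big_split_ord mulr_sumr /=; congr (_ + _); apply: eq_bigr => i _.
  by rewrite (unsplitK (inl i)) mulrA.
by rewrite (unsplitK (inr i)).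
Qed.

Lemma mem_ideal_gen S f : S f -> ideal_gen S f.
Proof.
by move=> Sf; exists 1%N, (fun=> 1), (fun=> f); rewrite big_ord1 mul1r.
Qed.

Lemma ideal_gen_sub S I : is_ideal I -> (forall f, S f -> I f) ->
  forall f, ideal_gen S f -> I f.
Proof.
move=> idI SI f [k [c [g [Sg ->]]]]; apply: is_ideal_sum => // i _.
by apply: is_idealM => //; exact: SI.
Qed.

(** The quotient by the kernel embeds into the domain T'. *)
Lemma kernel_prime (T' : idomainType) (phi : {rmorphism T -> T'}) I :
  (forall f, I f <-> phi f = 0) -> prime_ideal I.
Proof.
move=> IP; have memI f : (f \in mem I) = (phi f == 0).
  by apply/idP/eqP => [/set_mem/IP|/IP/mem_set].
split; first split=> [||a u v]; rewrite ?memI ?rmorph0 ?rmorph1 ?oner_eq0 //.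
  by move=> /eqP u0 /eqP v0; rewrite rmorphD rmorphM u0 v0 mulr0 addr0.
by move=> u v; rewrite !memI rmorphM mulf_eq0.
Qed.

End Ideals.

Section Criterion.
Variables (K : fieldType) (N : nat) (le : rel 'X_{1..N}).
Hypotheses (ole : term_order le) (wf : well_founded (strict le)).
Variables (T : idomainType) (phi : {rmorphism {mpoly K[N]} -> T}).
Variables (gs : seq {mpoly K[N]}) (I : set {mpoly K[N]}).
Hypotheses (idI : is_ideal I) (I_ker : forall f, I f -> phi f = 0).
Hypothesis gsI : forall g, g \in gs -> I g.
Hypothesis leads : forall f m, phi f = 0 -> is_lead le f m ->
  exists g mg, [/\ g \in gs, is_lead le g mg & (mg <= m)%MM].

(** Division by gs: cancelling the leading term of f with a multiple of a member
of gs stays in the kernel and lowers the leading monomial. *)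
Lemma kernel_sub f : phi f = 0 -> I f.
Proof.
have [-> _|nz_f] := eqVneq f 0; first by case: idI.
have [m lead_m] := is_lead_exists ole nz_f.
elim/(well_founded_ind wf): m f {nz_f} lead_m => m IHm f lead_m f0.
have [g [mg [gs_g [mg_g max_g] le_mg]]] := leads f0 lead_m.
have lc_g : g@_mg != 0 by rewrite mcoeff_eq0 negbK.
pose q := (f@_m / g@_mg) *: 'X_[(m - mg)%MM] * g.
have Iq : I q by apply: is_idealM => //; exact: gsI.
have -> : f = q + (f - q) by rewrite addrC subrK.
apply: is_idealD => //; have [->|nz_r] := eqVneq (f - q) 0; first by case: idI.
have [m' lead_m'] := is_lead_exists ole nz_r.
apply: (IHm m') => //; last by rewrite rmorphB /= f0 (I_ker Iq) subr0.
have def_m : m = (m - mg + mg)%MM by rewrite submK.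
have supp_q k : k \in msupp q -> le k m.
  rewrite /q -scalerAl => /msuppZ_le; rewrite mulrC (perm_mem (msuppMX _ _)).
  move=> /mapP [k' /max_g le_k' ->]; rewrite {2}def_m.
  exact: term_order_add ole _ _ _ le_k'.
have [m'_r _] := lead_m'; rewrite /strict; apply/andP; split.
  have /= := msuppB_le m'_r; rewrite mem_cat => /orP [|/supp_q //].
  by case: lead_m => _; exact.
apply: contraTneq m'_r => ->; rewrite -mcoeff_eq0 mcoeffB.
rewrite /q -scalerAl mcoeffZ ['X_[_] * g]mulrC.
have -> : (g * 'X_[m - mg])@_m = g@_mg
  by rewrite -[RHS](mcoeffMX g (m - mg)%MM mg) submK.
by rewrite divfK ?subrr.
Qed.

(** It suffices to find the leading monomials of the kernel among the multiples
of those of gs: division then shows that I is the whole kernel, whence both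
conclusions. *)
Lemma groebner_criterion : prime_ideal I /\ groebner_basis le gs I.
Proof.
have IP f : I f <-> phi f = 0 by split; [exact: I_ker | exact: kernel_sub].
split; first exact: kernel_prime IP.
split; first exact: gsI.
apply/seteqP; split; apply: ideal_gen_sub; try exact: is_ideal_gen.
  move=> h [f [m [Sf lead_m ->]]].
  have [g [mg [gs_g lead_g le_mg]]] := leads (I_ker Sf) lead_m.
  rewrite -(submK le_mg) mpolyXD; apply: is_idealM; first exact: is_ideal_gen.
  by apply: mem_ideal_gen; exists g, mg.
move=> h [f [m [Sf lead_m ->]]]; apply: mem_ideal_gen.
by exists f, m; split=> //; exact: gsI.
Qed.

End Criterion.

(** * Triangular substitutions and monomial maps *)

Lemma mnm_ind N (P : 'X_{1..N} -> Prop) :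
  P 0%MM -> (forall i m, P m -> P (U_(i) + m)%MM) -> forall m, P m.
Proof.
move=> P0 PS m; have [k] := ubnP (mdeg m); elim: k m => [//|k IHk] m lt_k.
have [->//|/eqP nz_m] := eqVneq m 0%MM.
have [i nz_i] : exists i, m i != 0%N.
  apply/existsP; apply: contra_notT nz_m => /existsPn z.
  by apply/mnmP => i; rewrite mnm0E; apply/eqP; have := z i; rewrite negbK.
have le_i : (U_(i) <= m)%MM by rewrite lep1mP.
rewrite -(submK le_i) addmC; apply/PS/IHk.
by move: lt_k; rewrite -{1}(submK le_i) mdegD mdeg1 addn1 ltnS.
Qed.

Section Triangular.
Variables (K : fieldType) (N : nat) (w : 'I_N -> nat).
Variable psi : {rmorphism {mpoly K[N]} -> {mpoly K[N]}}.
Hypothesis psiC : forall c, psi c%:MP = c%:MP.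
Hypothesis psiX : forall i m,
  m \in msupp (psi 'X_i - 'X_i) -> (weight w m < w i)%N.

(** Being a monomial plus terms of smaller weight is stable under products. *)
Lemma triangular_monomial m k :
  k \in msupp (psi 'X_[m] - 'X_[m]) -> (weight w k < weight w m)%N.
Proof.
elim/mnm_ind: m k => [|i m IHm] k.
  by rewrite mpolyX0 rmorph1 subrr msupp0.
rewrite mpolyXD rmorphM weightD weightU.
set p := psi _; set q := psi _.
(* Each of the three terms has a factor of strictly smaller weight. *)
have -> : p * q - 'X_i * 'X_[m] = (p - 'X_i) * (q - 'X_[m])
  + ((p - 'X_i) * 'X_[m] + 'X_i * (q - 'X_[m])) by ring.
have supp a b x y : (forall k, k \in msupp (a : {mpoly K[N]}) -> (weight w k < x)%N) ->
  (forall k, k \in msupp (b : {mpoly K[N]}) -> (weight w k <= y)%N) ->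
  forall k, k \in msupp (a * b) -> (weight w k < x + y)%N.
  move=> ax by_ k' /msuppM_le /allpairsP [[k1 k2] /= [/ax k1x /by_ k2y ->]].
  by rewrite weightD -addSn leq_add.
have suppX j : forall k, k \in msupp ('X_[j] : {mpoly K[N]}) -> (weight w k <= weight w j)%N.
  by move=> k'; rewrite msuppX inE => /eqP ->.
move=> /msuppD_le; rewrite mem_cat => /orP [|/msuppD_le].
  apply: supp => [|k' /IHm /ltnW //]; exact: psiX.
rewrite mem_cat => /orP [|].
  by apply: supp; [exact: psiX | exact: suppX].
rewrite mulrC addnC; apply: supp => [//|k' /suppX].
by rewrite weightU.
Qed.

(** Only monomials of smaller weight are added, and the order compares weights
first; so a Groebner basis can be computed after the substitution. *)
Lemma triangular_lead f m :
  is_lead (weight_le w) f m -> is_lead (weight_le w) (psi f) m.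
Proof.
move=> [m_f max_m]; have ole := weight_le_order w.
have psif : psi f = f + \sum_(k <- msupp f) f@_k *: (psi 'X_[k] - 'X_[k]).
  rewrite {1 2}[f]mpolyE rmorph_sum -big_split /=; apply: eq_bigr => k _.
  by rewrite -mul_mpolyC rmorphM psiC !mul_mpolyC scalerBr addrC subrK.
have small k : k \in msupp (psi f - f) -> (weight w k < weight w m)%N.
  rewrite psif addrC addKr; rewrite big_seq.
  move=> /msupp_sum_le /flattenP [s /mapP [k']].
  rewrite mem_filter => /andP [/max_m/weight_leW le_k' _] ->.
  by move=> /msuppZ_le /triangular_monomial lt_k; exact: leq_trans lt_k le_k'.
have m_psi : m \in msupp (psi f).
  rewrite mcoeff_msupp -[psi f](subrK f) mcoeffD.
  have -> : (psi f - f)@_m = 0.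
    by apply: memN_msupp_eq0; apply/negP => /small; rewrite ltnn.
  by rewrite add0r -mcoeff_msupp.
split=> // k; rewrite -[psi f](subrK f) => /msuppD_le; rewrite mem_cat.
by case/orP=> [/small lt_k|/max_m //]; rewrite /weight_le lt_k.
Qed.

End Triangular.

Section Toric.
Variables (K : fieldType) (N M : nat) (e : 'I_N -> 'X_{1..M}).

Definition toric_deg (m : 'X_{1..N}) : 'X_{1..M} := (\sum_i e i *+ m i)%MM.

Definition toric_map : {mpoly K[N]} -> {mpoly K[M]} :=
  mmap (@mpolyC M K) (fun i => 'X_[e i]).

HB.instance Definition _ := GRing.RMorphism.copy toric_map
  (mmap (@mpolyC M K) (fun i => 'X_[e i])).

Lemma toric_degE m j : toric_deg m j = (\sum_i m i * e i j)%N.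
Proof.
by rewrite /toric_deg mnm_sumE; apply: eq_bigr => i _; rewrite mulmnE mulnC.
Qed.

Lemma toric_degD m1 m2 :
  toric_deg (m1 + m2)%MM = (toric_deg m1 + toric_deg m2)%MM.
Proof.
apply/mnmP => j; rewrite mnmDE !toric_degE -big_split /=.
by apply: eq_bigr => i _; rewrite mnmDE mulnDl.
Qed.

Lemma toric_degU i : toric_deg U_(i)%MM = e i.
Proof.
apply/mnmP => j; rewrite toric_degE (bigD1 i) //= mnm1E eqxx mul1n.
by rewrite big1 ?addn0 // => k /negbTE ne_k; rewrite mnm1E eq_sym ne_k.
Qed.

Lemma toric_mapX m : toric_map 'X_[m] = 'X_[toric_deg m].
Proof.
by rewrite /toric_map mmapX /mmap1 mprodXnE.
Qed.

(** Otherwise nothing could cancel the image of the term of f at m. *)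
Lemma toric_kernel_fiber f m : toric_map f = 0 -> m \in msupp f ->
  exists m', [/\ m' \in msupp f, m' != m & toric_deg m' = toric_deg m].
Proof.
move=> f0 m_f.
have [/hasP [m' m'_f /andP [ne_m /eqP eq_d]]|/hasPn alone] :=
    boolP (has (fun m' => (m' != m) && (toric_deg m' == toric_deg m)) (msupp f)).
  by exists m'.
have := m_f; rewrite mcoeff_msupp => /negP []; apply/eqP.
have := congr1 (mcoeff (toric_deg m)) f0.
rewrite {1}[f]mpolyE rmorph_sum raddf_sum mcoeff0 /=.
rewrite (eq_big_seq (fun k => if k == m then f@_k else 0)) /=.
  rewrite (bigD1_seq m) ?msupp_uniq //= eqxx big1 ?addr0 // => k /negbTE ne_k.
  by rewrite ne_k.
move=> k k_f; rewrite -mul_mpolyC rmorphM /= toric_mapX /toric_map mmapC.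
rewrite mcoeffCM mcoeffX; case: (eqVneq k m) => [->|ne_k].
  by rewrite eqxx mulr1.
by have := alone k k_f; rewrite ne_k /= => /negbTE ->; rewrite mulr0.
Qed.

End Toric.

(** * Ideals of independence models *)

Section ModelIdeal.

Variables (R : comNzRingType) (n : nat) (d : 'I_n -> nat) (M : {set ci_statement n}).

Local Notation I := (@ci_model_ideal R n d M).

Lemma is_ideal_ci (s : ci_statement n) : is_ideal (@ci_ideal R n d s).
Proof. by case: s => [[A B] C']; exact: is_ideal_gen. Qed.

Lemma is_ideal_model : is_ideal I.
Proof.
split=> [|a u v [f [If ->]] [g [Ig ->]]].
  exists (fun=> 0); split=> [s _|]; last by rewrite big1.
  by case: (is_ideal_ci s).
exists (fun s => a * f s + g s); split=> [s Ms|]; last first.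
  by rewrite big_split mulr_sumr.
by case: (is_ideal_ci s) => _; apply; [exact: If | exact: Ig].
Qed.

Lemma mem_model (s : ci_statement n) f : s \in M -> ci_ideal s f -> I f.
Proof.
move=> Ms sf; exists (fun s' => if s' == s then f else 0); split=> [s' _|].
  by case: eqP => [->//|_]; case: (is_ideal_ci s').
by rewrite (bigD1 s) //= eqxx big1 ?addr0 // => s' /andP [_ /negbTE ->].
Qed.

End ModelIdeal.

(** * Pivots, blocks and swaps *)

Section Outcomes.

Variables (n : nat) (d : 'I_n -> nat) (d_pos : forall i, (0 < d i)%N).
Variables (C E : {set 'I_n}) (dis : [disjoint C & E]).
Variables (K : finType) (l0 : K) (blk : 'I_n -> K).

Local Notation T := (outcome d).
Implicit Types (u v s t : T) (Q : {set K}) (l : K) (A : {set 'I_n}).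

Definition restrict A u : T :=
  [ffun i => if i \in A then u i else Ordinal (d_pos i)].

Definition swap (S : {set 'I_n}) u v : T :=
  [ffun i => if i \in S then v i else u i].

Definition block l : {set 'I_n} := [set i | [&& i \notin C, i \notin E & blk i == l]]%SET.

Definition proj u : T := restrict (~: E) u.
(** One representative for each class of outcomes that agree outside E. *)
Definition pivot u : bool := proj u == u.
(** Index of the parameter of block l: the values on C and on the block, encoded
as an outcome to avoid another dependent type. *)
Definition part l u : T := restrict (C :|: block l) u.
(** Any total order on the values of a block will do; this is that of the
enumeration of the outcomes. *)
Definition coord l u : nat := enum_rank (restrict (block l) u).
Definition height u : nat := (\sum_l coord l u)%N.
Definition below s t : bool := [forall l, (coord l s <= coord l t)%N].
Definition labelled Q : {set 'I_n} := blk @^-1: Q.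

Definition same_context s t : Prop := forall i, i \in C -> s i = t i.

Lemma outcomeP u v : (forall i, u i = v i) <-> u = v.
Proof. by split=> [/ffunP|->]. Qed.

Lemma restrictP A u v :
  restrict A u = restrict A v <-> (forall i, i \in A -> u i = v i).
Proof.
split=> [eq_r i Ai|eq_uv].
  by have := (outcomeP _ _).2 eq_r i; rewrite !ffunE Ai.
by apply/outcomeP => i; rewrite !ffunE; case: ifP => // /eq_uv.
Qed.

Lemma pivotP u : reflect (forall i, i \in E -> u i = Ordinal (d_pos i)) (pivot u).
Proof.
apply: (iffP eqP) => [<- i Ei|zero_u]; first by rewrite ffunE inE Ei.
by apply/outcomeP => i; rewrite ffunE inE; case: (boolP (i \in E)) => //= /zero_u.
Qed.

Lemma pivot_restrict A u : [disjoint A & E] -> pivot (restrict A u).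
Proof.
move=> disA; apply/pivotP => i Ei; rewrite ffunE; case: ifP => // Ai.
by have := disjointFr disA Ai; rewrite Ei.
Qed.

Lemma disjoint_block l : [disjoint block l & E].
Proof.
rewrite -setI_eq0; apply/eqP/setP => i; rewrite !inE.
by case: (i \in E); rewrite ?andbF.
Qed.

Lemma pivot_proj u : pivot (proj u).
Proof. by apply: pivot_restrict; rewrite -setI_eq0 setIC setICr. Qed.

Lemma pivot_part l u : pivot (part l u).
Proof.
apply: pivot_restrict; rewrite -setI_eq0 setIUl setU_eq0 !setI_eq0.
by rewrite dis disjoint_block.
Qed.

Lemma proj_pivot u : pivot u -> proj u = u.
Proof. by move/eqP. Qed.

Lemma pivot_swap S s t : pivot s -> pivot t -> pivot (swap S s t).
Proof.
move=> /pivotP zs /pivotP zt; apply/pivotP => i Ei.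
by rewrite ffunE zs // zt // if_same.
Qed.

Lemma part_context l s t : part l s = part l t -> same_context s t.
Proof. by move=> /restrictP eq_st i Ci; apply: eq_st; rewrite inE Ci. Qed.

Lemma part_coord l s t : part l s = part l t -> coord l s = coord l t.
Proof.
move=> /restrictP eq_st; rewrite /coord; congr (nat_of_ord (enum_rank _)).
by apply/restrictP => i Bi; apply: eq_st; rewrite inE Bi orbT.
Qed.

Lemma coord_inj s t : pivot s -> pivot t -> same_context s t ->
  (forall l, coord l s = coord l t) -> s = t.
Proof.
move=> /pivotP zs /pivotP zt eq_C eq_l; apply/outcomeP => i.
have [/eq_C //|nCi] := boolP (i \in C).
have [Ei|nEi] := boolP (i \in E); first by rewrite zs ?zt.
have /ord_inj/enum_rank_inj/restrictP := eq_l (blk i); apply.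
by rewrite !inE nCi nEi /=.
Qed.

Lemma part_swap Q l s t : same_context s t ->
  part l (swap (labelled Q) s t) = if l \in Q then part l t else part l s.
Proof.
move=> eq_C; rewrite -fun_if; apply/restrictP => i.
rewrite !inE ffunE !inE; have [/eq_C eq_i _|_ /= /andP [_ /eqP ->]] := boolP (i \in C).
  by case: ifP; case: ifP.
by case: ifP.
Qed.

Lemma coord_swap Q l s t : same_context s t ->
  coord l (swap (labelled Q) s t) = if l \in Q then coord l t else coord l s.
Proof.
move=> eq_C; rewrite -fun_if; apply: part_coord.
by rewrite part_swap // -fun_if.
Qed.

Lemma same_context_sym s t : same_context s t -> same_context t s.
Proof. by move=> eq_st i /eq_st. Qed.

Lemma same_context_trans s t u : same_context s t -> same_context t u -> same_context s u.
Proof. by move=> eq_st eq_tu i Ci; rewrite eq_st ?eq_tu. Qed.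

Lemma below_height s t : below s t -> (height t <= height s)%N -> below t s.
Proof.
move=> /forallP le_st le_rk.
have := geq_leqif (leqif_sum (P := xpredT) (fun l _ => leqif_geq (le_st l))).
rewrite -/(height s) -/(height t) le_rk => /esym/forallP le_ts.
by apply/forallP => l; exact: le_ts.
Qed.

(** The exponent, in the monomial parametrization, of the image of an unknown.  An
unknown that is not a pivot has a parameter of its own; under the label l0 it
cannot clash with those of the blocks, which are indexed by pivots. *)
Definition exponent_of u : 'X_{1..#|{: K * T}|} :=
  if pivot u then (\sum_l U_(enum_rank (l, part l u)))%MM
  else U_(enum_rank (l0, u))%MM.

Definition exponent (i : 'I_#|T|) := exponent_of (enum_val i).

Lemma exponent_gt0 u l r : (0 < exponent_of u (enum_rank (l, r)))%N =
  if pivot u then r == part l u else (l0, u) == (l, r).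
Proof.
rewrite /exponent_of; case: ifP => _.
  rewrite mnm_sumE (bigD1 l) //= big1 => [|l' /negbTE ne_l].
    by rewrite addn0 mnm1E (inj_eq enum_rank_inj) xpair_eqE eqxx eq_sym lt0b.
  by rewrite mnm1E (inj_eq enum_rank_inj) xpair_eqE ne_l.
by rewrite mnm1E (inj_eq enum_rank_inj) lt0b.
Qed.

(** Within each label, a swap only exchanges the parameters of s and t. *)
Lemma exponent_swap Q s t : pivot s -> pivot t -> same_context s t ->
  (exponent_of s + exponent_of t =
   exponent_of (swap (labelled Q) s t) + exponent_of (swap (labelled Q) t s))%MM.
Proof.
move=> ps pt eq_C; have eq_C' := same_context_sym eq_C.
rewrite /exponent_of ps pt !pivot_swap // -!big_split /=.
apply: eq_bigr => l _; rewrite !part_swap //.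
by case: ifP => // _; rewrite addmC.
Qed.

(** Heights have the same sum over s, t as over their meet and join, but are
further apart for the latter, so the sum of the squared heights grows.  The
constant makes all pivots heavier than the other unknowns, so that the pivot
unknown leads its marginal. *)
Definition outcome_weight u : nat :=
  if pivot u then ((\sum_v height v ^ 2).+1 - height u ^ 2)%N else 0%N.

Definition unknown_weight (i : 'I_#|T|) : nat := outcome_weight (enum_val i).

Lemma height_sqr_lt u : (height u ^ 2 < (\sum_v height v ^ 2).+1)%N.
Proof. by rewrite ltnS (bigD1 u) //= leq_addr. Qed.

Lemma outcome_weight_gt0 u : pivot u -> (0 < outcome_weight u)%N.
Proof. by move=> pu; rewrite /outcome_weight pu subn_gt0 height_sqr_lt. Qed.

(** * Chains are the least monomials of the fibres *)

(** For pivots with the same values on C, swapping the labels on which s is above t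
yields the blockwise minimum and maximum of s and t. *)
Definition above_labels s t : {set K} := [set l | (coord l t < coord l s)%N]%SET.
Definition meet s t : T := swap (labelled (above_labels s t)) s t.
Definition join s t : T := swap (labelled (above_labels s t)) t s.

Lemma height_meet_ltl s t : same_context s t -> ~~ below s t ->
  (height (meet s t) < height s)%N.
Proof.
move=> eq_C; rewrite negb_forall => /existsP [l]; rewrite -ltnNge => lt_l.
rewrite /height (bigD1 l) //= [X in (_ < X)%N](bigD1 l) //= -addSn.
apply: leq_add; first by rewrite coord_swap // inE lt_l.
apply: leq_sum => l' _; rewrite coord_swap // inE.
by case: ifP => // /ltnW.
Qed.

Lemma height_meet_join s t : same_context s t ->
  (height (meet s t) + height (join s t) = height s + height t)%N.
Proof.
move=> eq_C; rewrite /height -!big_split /=; apply: eq_bigr => l _.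
rewrite !coord_swap //; last exact: same_context_sym.
by case: ifP => // _; rewrite addnC.
Qed.

Lemma height_meet_ltr s t : same_context s t -> ~~ below t s ->
  (height (meet s t) < height t)%N.
Proof.
move=> eq_C; rewrite negb_forall => /existsP [l]; rewrite -ltnNge => lt_l.
rewrite /height (bigD1 l) //= [X in (_ < X)%N](bigD1 l) //= -addSn.
apply: leq_add; first by rewrite coord_swap // inE (ltnNge (coord l t)) (ltnW lt_l).
apply: leq_sum => l' _; rewrite coord_swap // inE.
by case: ifP => //; rewrite ltnNge => /negbFE.
Qed.

Lemma outcome_weight_meet_join s t : pivot s -> pivot t -> same_context s t ->
  ~~ below s t -> ~~ below t s ->
  (outcome_weight (meet s t) + outcome_weight (join s t) < outcome_weight s + outcome_weight t)%N.
Proof.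
move=> ps pt eq_C n_st n_ts; rewrite /outcome_weight ps pt !pivot_swap //.
have := height_sqr_lt s; have := height_sqr_lt t.
have := height_sqr_lt (meet s t); have := height_sqr_lt (join s t).
have := height_meet_ltl eq_C n_st; have := height_meet_ltr eq_C n_ts.
have := height_meet_join eq_C; rewrite -/(meet s t) -/(join s t).
move: (\sum_v _ ^ 2)%N (height _) (height (join _ _)) (height s) (height t) => B a b x y.
nia.
Qed.

Definition chain (m : 'X_{1..#|T|}) : Prop := forall s t,
  pivot s -> pivot t -> same_context s t ->
  (0 < m (enum_rank s))%N -> (0 < m (enum_rank t))%N -> below s t || below t s.

(** In a chain, an element of maximal height is the largest one. *)
Lemma chain_top m u : chain m -> pivot u -> (0 < m (enum_rank u))%N ->
  exists t, [/\ pivot t, (0 < m (enum_rank t))%N, same_context u t &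
    forall s, pivot s -> (0 < m (enum_rank s))%N -> same_context u s -> below s t].
Proof.
move=> ch_m pu mu.
pose P t := [&& pivot t, (0 < m (enum_rank t))%N & restrict C u == restrict C t].
have Pu : P u by rewrite /P pu mu eqxx.
case: (arg_maxnP height Pu) => t /and3P [pt mt /eqP/restrictP eq_C] max_t.
exists t; split=> // s ps ms eq_s.
have eq_ts : same_context t s.
  exact: same_context_trans (same_context_sym eq_C) eq_s.
have /orP [le_ts|//] := ch_m _ _ pt ps eq_ts mt ms.
apply: below_height => //; apply: max_t; rewrite /P ps ms /=.
by apply/eqP/restrictP.
Qed.

Local Notation deg := (toric_deg exponent).

Lemma deg_witness m m' u l r : deg m = deg m' -> (0 < m (enum_rank u))%N ->
  (0 < exponent_of u (enum_rank (l, r)))%N ->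
  exists2 v, (0 < m' (enum_rank v))%N & (0 < exponent_of v (enum_rank (l, r)))%N.
Proof.
move=> eq_deg mu eu; have := congr1 (fun k : 'X_{1.._} => k (enum_rank (l, r))) eq_deg.
rewrite !toric_degE (bigD1 (enum_rank u)) //= /exponent enum_rankK => eq_sum.
have [/existsP [i nz_i]|/existsPn z] :=
    boolP [exists i, m' i * exponent_of (enum_val i) (enum_rank (l, r)) != 0]%N; last first.
  move: eq_sum; rewrite [RHS]big1 => [|i _]; last by have := z i; rewrite negbK => /eqP.
  move/eqP; rewrite addn_eq0 muln_eq0 (eqn0Ngt (m _)) (eqn0Ngt (exponent_of u _)).
  by rewrite mu eu.
exists (enum_val i); rewrite ?enum_valK lt0n.
  by apply: contraNneq nz_i => ->.
by apply: contraNneq nz_i => ->; rewrite muln0.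
Qed.

(** The image of m records, for each label, which parts the pivots in m have. *)
Lemma deg_part m m' u l : deg m = deg m' -> pivot u -> (0 < m (enum_rank u))%N ->
  exists v, [/\ pivot v, (0 < m' (enum_rank v))%N & part l v = part l u].
Proof.
move=> eq_deg pu mu.
have [|v m'v] := @deg_witness m m' u l (part l u) eq_deg mu.
  by rewrite exponent_gt0 pu eqxx.
rewrite exponent_gt0; case: ifP => [pv /eqP ->|npv /eqP [_ def_v]]; first by exists v.
by rewrite def_v pivot_part in npv.
Qed.

(** A shared variable: an unknown that is not a pivot can be read off the image;
the largest pivot with given values on C has, for each label, the largest
coordinate that occurs, and this too is determined by the image. *)
Lemma chain_common m m' u : chain m -> chain m' -> deg m = deg m' ->
  (0 < m (enum_rank u))%N ->
  exists v, (0 < m (enum_rank v))%N && (0 < m' (enum_rank v))%N.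
Proof.
move=> ch_m ch_m' eq_deg mu; have [pu|npu] := boolP (pivot u); last first.
  have [|v m'v] := @deg_witness m m' u l0 u eq_deg mu.
    by rewrite exponent_gt0 (negbTE npu) eqxx.
  rewrite exponent_gt0; case: ifP => [pv /eqP def_u|_ /eqP [eq_vu]].
    by rewrite def_u pivot_part in npu.
  by exists u; rewrite mu -eq_vu m'v.
have [t [pt mt ut max_t]] := chain_top ch_m pu mu.
have [v [pv m'v /part_context vu]] := deg_part l0 eq_deg pu mu.
have [t' [pt' m't' vt' max_t']] := chain_top ch_m' pv m'v.
have tt' : same_context t t'.
  apply: same_context_trans (same_context_sym ut) _.
  exact: same_context_trans (same_context_sym vu) vt'.
exists t; rewrite mt; suff -> : t = t' by [].
apply: coord_inj => // l; apply/eqP; rewrite eqn_leq; apply/andP; split.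
  have [s [ps m's eq_s]] := deg_part l eq_deg pt mt.
  rewrite -(part_coord eq_s); apply: (forallP (max_t' s ps m's _)).
  apply: same_context_trans (same_context_trans vt' (same_context_sym tt')) _.
  exact: same_context_sym (part_context eq_s).
have [s [ps ms eq_s]] := deg_part l (esym eq_deg) pt' m't'.
rewrite -(part_coord eq_s); apply: (forallP (max_t s ps ms _)).
apply: same_context_trans (same_context_trans ut tt') _.
exact: same_context_sym (part_context eq_s).
Qed.

Lemma chain_sub m m' : (m <= m')%MM -> chain m' -> chain m.
Proof.
move=> /mnm_lepP le_m ch s t ps pt eq_C ms mt.
by apply: ch => //; [exact: leq_trans ms _ | exact: leq_trans mt _].
Qed.

(** Induction on the degree, dividing by a common variable. *)
Lemma chain_uniq m m' : chain m -> chain m' -> deg m = deg m' -> m = m'.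
Proof.
have [k] := ubnP (mdeg m + mdeg m'); elim: k m m' => [//|k IHk] m m' lt_k ch ch' eq_deg.
have common : forall v, (0 < m (enum_rank v))%N && (0 < m' (enum_rank v))%N -> m = m'.
  move=> v /andP [mv m'v].
  have le_m : (U_(enum_rank v) <= m)%MM by rewrite lep1mP -lt0n.
  have le_m' : (U_(enum_rank v) <= m')%MM by rewrite lep1mP -lt0n.
  rewrite -(submK le_m) -(submK le_m'); congr (_ + _)%MM.
  apply: IHk.
  - move: lt_k; rewrite -{1}(submK le_m) -{1}(submK le_m') !mdegD mdeg1; lia.
  - exact: chain_sub (lem_subr _ _) ch.
  - exact: chain_sub (lem_subr _ _) ch'.
  move: eq_deg; rewrite -{1}(submK le_m) -{1}(submK le_m') !toric_degD.
  exact: addIm.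
have nonzero k' : k' != 0%MM -> exists v : T, (0 < k' (enum_rank v))%N.
  move=> nz; apply/existsP; apply: contraNT nz => /existsPn z; apply/eqP/mnmP => i.
  by have := z (enum_val i); rewrite enum_valK -eqn0Ngt mnm0E => /eqP.
have [m0|/nonzero [u mu]] := eqVneq m 0%MM.
  have [m'0|/nonzero [u m'u]] := eqVneq m' 0%MM; first by rewrite m0 m'0.
  have [v] := chain_common ch' ch (esym eq_deg) m'u.
  by rewrite andbC => /common.
by have [v /common] := chain_common ch ch' eq_deg mu.
Qed.

Lemma not_chain m : ~ chain m -> exists s t,
  [/\ pivot s, pivot t, same_context s t, ~~ below s t & ~~ below t s] /\
  (U_(enum_rank s) + U_(enum_rank t) <= m)%MM.
Proof.
move=> nch; have [/existsP [s /existsP [t]]|/existsPn no] := boolP [exists s, exists t,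
    [&& pivot s, pivot t, restrict C s == restrict C t, (0 < m (enum_rank s))%N,
        (0 < m (enum_rank t))%N, ~~ below s t & ~~ below t s]].
  case/and5P => ps pt /eqP/restrictP eq_C ms /and3P [mt n_st n_ts]; exists s, t; split=> //.
  apply/mnm_lepP => i; rewrite mnmDE !mnm1E.
  have ne_st : s != t.
    by apply: contraNneq n_st => ->; apply/forallP.
  have [<-|_] := eqVneq (enum_rank s) i; last by case: eqP => [<-|].
  by rewrite (inj_eq enum_rank_inj) eq_sym (negbTE ne_st).
case: nch => s t ps pt eq_C ms mt; have /existsPn/(_ t) := no s.
have /restrictP -> := eq_C.
by rewrite ps pt ms mt eqxx /= -negb_or negbK.
Qed.

(** Replacing s, t by their meet and join keeps the image and lowers the weight. *)
Lemma fiber_descent m s t : pivot s -> pivot t -> same_context s t ->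
  ~~ below s t -> ~~ below t s -> (U_(enum_rank s) + U_(enum_rank t) <= m)%MM ->
  exists m', deg m' = deg m /\ (weight unknown_weight m' < weight unknown_weight m)%N.
Proof.
move=> ps pt eq_C n_st n_ts le_m.
exists (m - (U_(enum_rank s) + U_(enum_rank t)) +
  (U_(enum_rank (meet s t)) + U_(enum_rank (join s t))))%MM.
rewrite -[in deg m](submK le_m) -[in weight unknown_weight m](submK le_m).
rewrite !toric_degD !weightD !weightU !toric_degU /unknown_weight /exponent !enum_rankK.
by rewrite ltn_add2l outcome_weight_meet_join // -exponent_swap.
Qed.

(** A monomial below m in its fibre is either a chain, hence m itself, or can be
lowered further; the weight bounds the number of steps. *)
Lemma chain_minimal m m' : chain m -> deg m' = deg m ->
  weight_le unknown_weight m' m -> m' = m.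
Proof.
move=> ch; have [k] := ubnP (weight unknown_weight m').
elim: k m' => [//|k IHk] m' lt_k eq_deg le_m.
have [ch'|/not_chain [s [t [[ps pt eq_C n_st n_ts] le_st]]]] := EM (chain m').
  exact: chain_uniq.
have [m'' [eq_deg' lt_m'']] := fiber_descent ps pt eq_C n_st n_ts le_st.
have lt_m : (weight unknown_weight m'' < weight unknown_weight m)%N.
  exact: leq_trans lt_m'' (weight_leW le_m).
have eq_m : m'' = m.
  apply: IHk; [exact: leq_trans lt_m'' _ | by rewrite eq_deg' |].
  by rewrite /weight_le lt_m.
by rewrite eq_m ltnn in lt_m.
Qed.

(** * The parametrization and its kernel *)

Section Parametrization.

Variable F : fieldType.
Local Notation ring := {mpoly F[#|T|]}.

(** The marginal of the pivot t over the variables in E. *)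
Definition form t : ring := \sum_(u | proj u == t) unknown F u.

Definition quad s t : ring := form s * form t - form (meet s t) * form (join s t).

Definition tail (i : 'I_#|T|) : ring :=
  if pivot (enum_val i)
  then \sum_(v | (proj v == enum_val i) && (v != enum_val i)) unknown F v else 0.

(** The substitution that sends the marginal of a pivot t to the unknown of t. *)
Definition shear : ring -> ring :=
  mmap (@mpolyC #|T| F) (fun i => 'X_i - tail i).

HB.instance Definition _ := GRing.RMorphism.copy shear
  (mmap (@mpolyC #|T| F) (fun i => 'X_i - tail i)).

Definition param : ring -> {mpoly F[#|{: K * T}|]} :=
  @toric_map F _ _ exponent \o shear.

HB.instance Definition _ := GRing.RMorphism.copy param (@toric_map F _ _ exponent \o shear).

Lemma shearX i : shear 'X_i = 'X_i - tail i.
Proof. by rewrite /shear mmapX mmap1U. Qed.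

Lemma shear_triangular i m :
  m \in msupp (shear 'X_i - 'X_i) -> (weight unknown_weight m < unknown_weight i)%N.
Proof.
rewrite shearX addrAC subrr add0r (perm_mem (msuppN _)) /tail.
case: ifP => [pi_i|_]; last by rewrite msupp0.
move=> /msupp_sum_le /flattenP [_ /mapP [v + ->]].
rewrite mem_filter => /andP [/andP [/eqP pv ne_v] _].
rewrite msuppX inE => /eqP ->.
rewrite weightU /unknown_weight enum_rankK {1}/outcome_weight ifF ?outcome_weight_gt0 //.
by apply: contraNF ne_v => /proj_pivot <-; rewrite pv.
Qed.

Lemma shear_form t : pivot t -> shear (form t) = unknown F t.
Proof.
move=> pt; rewrite /form rmorph_sum (bigD1 t) /=; last exact: pt.
rewrite shearX /tail enum_rankK pt -/(unknown F t).
rewrite -[RHS](subrK (\sum_(v | (proj v == t) && (v != t)) unknown F v)).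
congr (_ + _); apply: eq_bigr => v /andP [/eqP pv ne_v].
rewrite shearX /tail enum_rankK ifF ?subr0 //.
by apply: contraNF ne_v => /proj_pivot <-; rewrite pv.
Qed.

Lemma param_form t : pivot t -> param (form t) = 'X_[exponent_of t].
Proof.
move=> pt; rewrite /param /= shear_form // toric_mapX toric_degU.
by rewrite /exponent enum_rankK.
Qed.

(** The substitution turns the quadric into a binomial with this leading monomial,
and it preserves leading monomials. *)
Lemma quad_lead s t : pivot s -> pivot t -> same_context s t ->
  ~~ below s t -> ~~ below t s ->
  is_lead (weight_le unknown_weight) (quad s t) (U_(enum_rank s) + U_(enum_rank t))%MM.
Proof.
move=> ps pt eq_C n_st n_ts; have ole := weight_le_order unknown_weight.
have lt_w : (weight unknown_weight (U_(enum_rank (meet s t)) + U_(enum_rank (join s t)))%MM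
    < weight unknown_weight (U_(enum_rank s) + U_(enum_rank t))%MM)%N.
  by rewrite !weightD !weightU /unknown_weight !enum_rankK outcome_weight_meet_join.
have sh : shear (quad s t) = 'X_[(U_(enum_rank s) + U_(enum_rank t))] -
    'X_[(U_(enum_rank (meet s t)) + U_(enum_rank (join s t)))].
  by rewrite /quad rmorphB !rmorphM /= !shear_form ?pivot_swap // !mpolyXD.
have lead_sh : is_lead (weight_le unknown_weight) (shear (quad s t))
    (U_(enum_rank s) + U_(enum_rank t))%MM.
  rewrite sh; split=> [|m].
    rewrite mcoeff_msupp mcoeffB !mcoeffX eqxx.
    have /negbTE -> : (U_(enum_rank (meet s t)) + U_(enum_rank (join s t)) !=
        U_(enum_rank s) + U_(enum_rank t))%MM.
      by apply: contraTneq lt_w => ->; rewrite ltnn.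
    by rewrite subr0 oner_neq0.
  move=> /msuppB_le; rewrite mem_cat !msuppX !inE => /orP [] /eqP ->.
    exact: term_order_refl.
  by rewrite /weight_le lt_w.
have [] // := @is_lead_exists F _ _ ole (quad s t).
  apply: contraTneq (proj1 lead_sh) => ->.
  by rewrite rmorph0 msupp0.
move=> m lead_m; have -> // := is_lead_uniq ole lead_sh (_ : is_lead _ _ m).
by apply: triangular_lead => //; [move=> c; exact: mmapC | exact: shear_triangular].
Qed.

Lemma msupp_form t m : m \in msupp (form t) -> mdeg m = 1%N.
Proof.
move=> /msupp_sum_le /flattenP [_ /mapP [v _ ->]].
by rewrite msuppX inE => /eqP ->; exact: mdeg1.
Qed.

Lemma quad_quadratic s t : pivot s -> pivot t -> same_context s t ->
  ~~ below s t -> ~~ below t s -> quadratic (quad s t).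
Proof.
move=> ps pt eq_C n_st n_ts; rewrite /quadratic; apply/eqP; rewrite eqn_leq.
have [supp_g _] := quad_lead ps pt eq_C n_st n_ts.
have := msize_mdeg_lt supp_g; rewrite mdegD !mdeg1 => ->; rewrite andbT.
rewrite msizeE; apply/bigmax_leqP_seq => m + _.
have lin2 a b k : k \in msupp (form a * form b) -> (mdeg k < 3)%N.
  move=> /msuppM_le /allpairsP [[k1 k2] /= [/msupp_form k1_1 /msupp_form k2_1 ->]].
  by rewrite mdegD k1_1 k2_1.
by move=> /msuppB_le; rewrite mem_cat => /orP [] /lin2.
Qed.

Definition incomparable s t : bool :=
  [&& pivot s, pivot t, restrict C s == restrict C t, ~~ below s t & ~~ below t s].

Lemma incomparableP s t : reflect
  [/\ pivot s, pivot t, same_context s t, ~~ below s t & ~~ below t s]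
  (incomparable s t).
Proof.
apply: (iffP and5P) => [] [ps pt eq_C n_st n_ts]; split=> //.
  by apply/restrictP/eqP.
by apply/eqP/restrictP.
Qed.

Definition quads : seq ring :=
  [seq quad p.1 p.2 | p <- enum {: T * T} & incomparable p.1 p.2].

Lemma mem_quads s t : incomparable s t -> quad s t \in quads.
Proof.
move=> inc; apply/mapP; exists (s, t) => //.
by rewrite mem_filter inc mem_enum.
Qed.

Lemma quadsP g : g \in quads -> exists s t, incomparable s t /\ g = quad s t.
Proof.
move=> /mapP [[s t]]; rewrite mem_filter => /andP [inc _] ->.
by exists s, t.
Qed.

(** The leading monomial m of f survives the substitution, whose result has
another, hence smaller, monomial in the fibre of m; so m is not a chain. *)
Lemma param_leads f m : param f = 0 -> is_lead (weight_le unknown_weight) f m ->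
  exists g mg, [/\ g \in quads, is_lead (weight_le unknown_weight) g mg & (mg <= m)%MM].
Proof.
move=> f0 lead_m.
have [m_sh max_m] : is_lead (weight_le unknown_weight) (shear f) m.
  by apply: triangular_lead => //; [move=> c; exact: mmapC | exact: shear_triangular].
have [m' [m'_sh ne_m' eq_deg]] := toric_kernel_fiber f0 m_sh.
have [/chain_minimal ch_m|/not_chain [s [t [inc le_m]]]] := EM (chain m).
  by move: ne_m'; rewrite (ch_m _ eq_deg (max_m _ m'_sh)) eqxx.
exists (quad s t), (U_(enum_rank s) + U_(enum_rank t))%MM; split=> //.
  exact/mem_quads/incomparableP.
by case: inc; exact: quad_lead.
Qed.

Lemma quads_groebner (I : set ring) : is_ideal I ->
  (forall f, I f -> param f = 0) ->
  (forall s t, incomparable s t -> I (quad s t)) ->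
  prime_quadratic I.
Proof.
move=> idI I_ker I_quad; have ole := weight_le_order unknown_weight.
have [|pI gb] := groebner_criterion ole (@weight_le_wf _ unknown_weight)
  (phi := param) idI I_ker _ param_leads.
  by move=> g /quadsP [s [t [inc ->]]]; exact: I_quad.
split=> //; exists (weight_le unknown_weight), quads; split=> // g.
move=> /quadsP [s [t [/incomparableP inc ->]]].
by case: inc; exact: quad_quadratic.
Qed.

(** * Minors and swaps of blocks *)

Lemma eq_swap (S S' : {set 'I_n}) s t : pivot s -> pivot t -> same_context s t ->
  (forall i, i \notin C -> i \notin E -> (i \in S) = (i \in S')) ->
  swap S s t = swap S' s t.
Proof.
move=> /pivotP zs /pivotP zt eq_C eq_S; apply/outcomeP => i; rewrite !ffunE.
have [/eq_C ->|nCi] := boolP (i \in C); first by rewrite !if_same.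
have [Ei|nEi] := boolP (i \in E); first by rewrite zs // zt // !if_same.
by rewrite eq_S.
Qed.

Lemma agreesP A u (a : values d A) :
  reflect (forall i (Ai : i \in A), u i = a (exist _ i Ai)) (agrees u a).
Proof.
apply: (iffP forallP) => [eq_a i Ai|eq_a [i Ai]]; last by rewrite eq_a.
by have /eqP := eq_a (exist _ i Ai).
Qed.

Lemma agrees_eq A u v (a : values d A) : (forall i, i \in A -> u i = v i) ->
  agrees u a = agrees v a.
Proof.
by move=> eq_uv; apply/agreesP/agreesP => eq_a i Ai; rewrite -eq_a eq_uv.
Qed.

Lemma agrees_same A u v (a : values d A) : agrees u a -> agrees v a ->
  forall i, i \in A -> u i = v i.
Proof. by move=> /agreesP eq_u /agreesP eq_v i Ai; rewrite eq_u eq_v. Qed.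

Lemma agrees_swap_in A (S : {set 'I_n}) u v (a : values d A) : A \subset S ->
  agrees (swap S u v) a = agrees v a.
Proof. by move=> sAS; apply: agrees_eq => i Ai; rewrite ffunE (fintype.subsetP sAS). Qed.

Lemma agrees_swap_out A (S : {set 'I_n}) u v (a : values d A) : [disjoint A & S] ->
  agrees (swap S u v) a = agrees u a.
Proof.
by move=> disAS; apply: agrees_eq => i Ai; rewrite ffunE (disjointFr disAS Ai).
Qed.

Lemma agrees_proj A u (a : values d A) : [disjoint A & E] ->
  agrees (proj u) a = agrees u a.
Proof.
move=> disAE; apply: agrees_eq => i Ai.
by rewrite ffunE inE (disjointFr disAE Ai).
Qed.

Lemma marginal_sum_form A1 A2 A3 (a1 : values d A1) (a2 : values d A2) (a3 : values d A3) :
  [disjoint A1 & E] -> [disjoint A2 & E] -> [disjoint A3 & E] ->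
  marginal F a1 a2 a3 =
  \sum_(t | pivot t && [&& agrees t a1, agrees t a2 & agrees t a3]) form t.
Proof.
move=> d1 d2 d3; rewrite /marginal.
rewrite (partition_big proj
  (fun t => pivot t && [&& agrees t a1, agrees t a2 & agrees t a3])) /=; last first.
  by move=> u; rewrite pivot_proj !agrees_proj.
apply: eq_bigr => t /andP [_ at_]; apply: eq_bigl => u.
by apply: andb_idl => /eqP eq_t; move: at_; rewrite -eq_t !agrees_proj.
Qed.

Lemma marginal_form A1 A2 A3 (a1 : values d A1) (a2 : values d A2) (a3 : values d A3) t :
  A1 :|: A2 :|: A3 = ~: E -> pivot t -> agrees t a1 -> agrees t a2 -> agrees t a3 ->
  marginal F a1 a2 a3 = form t.
Proof.
move=> cover pt t1 t2 t3.
have dE A : {subset A <= A1 :|: A2 :|: A3} -> [disjoint A & E].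
  rewrite cover => sA; rewrite -setI_eq0; apply/eqP/setP => i; rewrite !inE.
  by apply/negP => /andP [/sA]; rewrite inE => /negP.
rewrite marginal_sum_form; try by apply: dE => i Ai; rewrite !inE Ai ?orbT.
rewrite (big_pred1 t) // => u; apply/idP/eqP => [|->]; last by rewrite pt t1 t2.
case/and4P => pu u1 u2 u3; rewrite -(proj_pivot pt) -(proj_pivot pu).
apply/restrictP => i; rewrite -cover !inE -orbA.
case/or3P; [exact: agrees_same u1 t1 _|exact: agrees_same u2 t2 _|exact: agrees_same u3 t3 _].
Qed.

(** Stable under the relation of being in the same block. *)
Definition blockwise (S : {set 'I_n}) : Prop := forall i j, i \in S ->
  j \notin C -> j \notin E -> blk i = blk j -> j \in S.

Lemma swap_blockwise S s t : pivot s -> pivot t -> same_context s t ->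
  blockwise S -> swap S s t = swap (labelled (blk @: S)) s t.
Proof.
move=> ps pt eq_C bS; apply: eq_swap => // i nC nE; rewrite inE.
apply/idP/imsetP => [Si|[j Sj eq_b]]; first by exists i.
exact: bS Sj nC nE _.
Qed.

(** Expanding both products over pairs of pivots, the swap of A2 is a bijection
between the pairs of pivots for the first and for the second product; it keeps
the image of the product of the two unknowns because A2 consists of whole
blocks. *)
Lemma param_minor A1 A2 A3 (a a' : values d A1) (b b' : values d A2) (c : values d A3) :
  [disjoint A1 & E] -> [disjoint A2 & E] -> [disjoint A3 & E] ->
  C \subset A3 -> [disjoint A1 & A2] -> [disjoint A3 & A2] -> blockwise A2 ->
  param (marginal F a b c * marginal F a' b' c - marginal F a b' c * marginal F a' b c) = 0.
Proof.
move=> d1 d2 d3 sC d12 d32 bA2.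
have par (x : values d A1) (y : values d A2) : param (marginal F x y c) =
    \sum_(t | pivot t && [&& agrees t x, agrees t y & agrees t c]) 'X_[exponent_of t].
  rewrite marginal_sum_form // rmorph_sum; apply: eq_bigr => t /andP [pt _].
  exact: param_form.
apply/eqP; rewrite rmorphB !rmorphM subr_eq0 /= !par !big_distrlr /= !pair_big /=.
pose f (p : T * T) := (swap A2 p.1 p.2, swap A2 p.2 p.1).
have fK : involutive f.
  have swapK u v : swap A2 (swap A2 u v) (swap A2 v u) = u.
    by apply/outcomeP => i; rewrite !ffunE; case: (i \in A2).
  by move=> [s t]; rewrite /f /= !swapK.
have pf u v : pivot (swap A2 u v) = pivot u.
  by apply/pivotP/pivotP => zu i Ei; have := zu i Ei; rewrite ffunE (disjointFl d2 Ei).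
rewrite (reindex_inj (inv_inj fK)) /=; apply/eqP; apply: eq_big => [[s t]|[s t]] /=.
  rewrite !pf !(agrees_swap_in _ _ _ (subxx A2)).
  rewrite !(agrees_swap_out _ _ _ d12) !(agrees_swap_out _ _ _ d32).
  by case: (agrees t b); case: (agrees s b'); rewrite ?andbF.
rewrite !pf !(agrees_swap_out _ _ _ d32) => /andP [/and4P [ps _ _ sc] /and4P [pt _ _ tc]].
rewrite -!mpolyXD; congr 'X_[_].
have eq_C : same_context s t.
  by move=> i /(fintype.subsetP sC) A3i; exact: agrees_same sc tc i A3i.
have eq_C' := same_context_sym eq_C.
by rewrite (swap_blockwise ps pt) // (swap_blockwise pt ps) // -exponent_swap.
Qed.

Section Model.

Variable M : {set ci_statement n}.

(** Each block is separated from all the other kept variables by a statement of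
the model: enough for the model ideal to contain the quadrics. *)
Definition separating : Prop := forall i, i \notin C -> i \notin E ->
  exists A B, [/\ (A, B, C) \in M, A :|: B :|: C = ~: E, [disjoint A & B] &
    block (blk i) = A \/ block (blk i) = B].

(** The statements follow from the mutual independence of the blocks given C:
enough for the model ideal to lie in the kernel. *)
Definition implied : Prop := forall A1 A2 A3, (A1, A2, A3) \in M ->
  A2 = set0 \/ [/\ [disjoint A1 & E], [disjoint A2 & E] & [disjoint A3 & E]] /\
    [/\ C \subset A3, [disjoint A1 & A2], [disjoint A3 & A2] & blockwise A2].

Local Notation I := (@ci_model_ideal F n d M).

Lemma model_sub_kernel : implied -> forall f, I f -> param f = 0.
Proof.
move=> imp f [g [Ig ->]]; rewrite rmorph_sum big1 // => -[[A1 A2] A3] Ms /=.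
have : is_ideal [set h | param h = 0]%classic.
  split=> [|a u v /= u0 v0]; first exact: rmorph0.
  by rewrite rmorphD rmorphM /= u0 v0 mulr0 addr0.
move: (Ig _ Ms) => Igs idK.
apply: (ideal_gen_sub idK _ Igs) => _ [a [a' [b [b' [c ->]]]]] /=.
have [A0|[[d1 d2 d3] [sC d12 d32 bA]]] := imp _ _ _ Ms; last exact: param_minor.
suff -> : b' = b by rewrite subrr rmorph0.
by apply/ffunP => -[i Ai]; exfalso; have := Ai; rewrite A0 inE.
Qed.

(** This is the 2x2 minor whose rows are the A-values of s and t, and whose
columns are their B-values. *)
Lemma swap_form (A B : {set 'I_n}) s t : (A, B, C) \in M -> A :|: B :|: C = ~: E ->
  [disjoint A & B] -> pivot s -> pivot t -> same_context s t ->
  I (form s * form t - form (swap A s t) * form (swap A t s)).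
Proof.
move=> MABC cover dAB ps pt eq_C; apply: (@mem_model F n d M _ _ MABC).
apply: mem_ideal_gen.
pose vals (A' : {set 'I_n}) u : values d A' := [ffun i => u (val i)].
have valsP A' u v : (forall i, i \in A' -> u i = v i) -> agrees u (vals A' v).
  by move=> eq_uv; apply/agreesP => i Ai; rewrite ffunE /= eq_uv.
exists (vals A s), (vals A t), (vals B s), (vals B t), (vals C s).
have ml (x y z : T) : pivot z -> (forall i, i \in A -> z i = x i) ->
    (forall i, i \in B -> z i = y i) -> same_context z s ->
    marginal F (vals A x) (vals B y) (vals C s) = form z.
  by move=> pz zx zy zs; apply: marginal_form => //; exact: valsP.
rewrite (ml s s s) // (ml t t t) //; last exact: same_context_sym.
rewrite (ml s t (swap A t s)) ?(ml t s (swap A s t)) ?pivot_swap //.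
- by rewrite [form (swap A s t) * _]mulrC.
- by move=> i Ai; rewrite ffunE Ai.
- by move=> i Bi; rewrite ffunE (disjointFl dAB Bi).
- by move=> i Ci; rewrite ffunE eq_C // if_same.
- by move=> i Ai; rewrite ffunE Ai.
- by move=> i Bi; rewrite ffunE (disjointFl dAB Bi).
- by move=> i Ci; rewrite ffunE eq_C // if_same.
Qed.

(** If the statement has the block as its second set B, swapping B amounts to
swapping A with the roles of s and t exchanged. *)
Lemma swap_label_form l s t : separating -> pivot s -> pivot t -> same_context s t ->
  I (form s * form t - form (swap (labelled [set l]) s t) * form (swap (labelled [set l]) t s)).
Proof.
move=> sep ps pt eq_C; have eq_C' := same_context_sym eq_C.
have to_block u v : pivot u -> pivot v -> same_context u v ->
    swap (labelled [set l]) u v = swap (block l) u v.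
  by move=> pu pv eq_uv; apply: eq_swap => // i nC nE; rewrite !inE nC nE.
rewrite !to_block //; have [->|[i]] := set_0Vmem (block l).
  have empty u v : swap set0 u v = u by apply/outcomeP => i; rewrite ffunE inE.
  by rewrite !empty subrr; case: (is_ideal_model F d M).
rewrite inE => /and3P [nC nE /eqP <-].
have [A [B [MABC cover dAB bAB]]] := sep i nC nE.
have [defA|defB] := bAB; first by rewrite defA; exact: (swap_form MABC).
have co u v : pivot u -> pivot v -> same_context u v -> swap B u v = swap A v u.
  move=> /pivotP zu /pivotP zv eq_uv; apply/outcomeP => j; rewrite !ffunE.
  have [/eq_uv ->|nCj] := boolP (j \in C); first by rewrite !if_same.
  have [Ej|nEj] := boolP (j \in E); first by rewrite zu // zv // !if_same.
  have := congr1 (fun S : {set 'I_n} => j \in S) cover; rewrite !inE (negbTE nCj) nEj orbF.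
  have := disjointFr dAB (x := j); case: (j \in A) => [-> //|_ /= ->//].
by rewrite defB !co // [form (swap A t s) * _]mulrC; exact: (swap_form MABC).
Qed.

(** Telescoping: the labels in Q are swapped one after the other. *)
Lemma swap_labels_form (Q : {set K}) s t : separating -> pivot s -> pivot t -> same_context s t ->
  I (form s * form t - form (swap (labelled Q) s t) * form (swap (labelled Q) t s)).
Proof.
move=> sep ps pt eq_C; have eq_C' := same_context_sym eq_C.
have -> : labelled Q = [set i | blk i \in enum Q].
  by apply/setP => i; rewrite !inE mem_enum.
elim: (enum Q) (enum_uniq Q) => [_|l r IHr /= /andP [nlr /IHr]].
  have nil u v : swap [set i | blk i \in [::]] u v = u.
    by apply/outcomeP => i; rewrite !ffunE inE.
  by rewrite !nil subrr; case: (is_ideal_model F d M).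
set S := [set i | blk i \in r]; set s' := swap S s t; set t' := swap S t s.
move=> Ist; have step u v : swap [set i | blk i \in l :: r] u v =
    swap (labelled [set l]) (swap S u v) (swap S v u).
  apply/outcomeP => i; rewrite !ffunE !inE.
  have [->|//] := eqVneq (blk i) l; by rewrite (negbTE nlr).
have eq_C2 : same_context s' t'.
  by move=> i Ci; rewrite !ffunE eq_C // !if_same.
rewrite !step -/s' -/t'.
rewrite -[form s * form t](subrK (form s' * form t')) -addrA.
apply: is_idealD (is_ideal_model F d M) Ist _.
by apply: swap_label_form; rewrite ?pivot_swap.
Qed.

Lemma model_groebner : separating -> implied -> prime_quadratic I.
Proof.
move=> sep imp; apply: quads_groebner; first exact: is_ideal_model.
  exact: model_sub_kernel.
by move=> s t /incomparableP [ps pt eq_C _ _]; exact: swap_labels_form.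
Qed.

End Model.
End Parametrization.
End Outcomes.

(** * Bayesian networks on three vertices *)

Lemma block_id n (C E : {set 'I_n}) x : x \notin C -> x \notin E ->
  block C E id x = [set x].
Proof.
move=> nC nE; apply/setP => y; rewrite !inE.
by have [->|_] := eqVneq y x; rewrite ?nC ?nE ?andbF.
Qed.

Section LocalMarkov.

Variables (n : nat) (G : rel 'I_n).

Lemma disjoint_nondescendents i : [disjoint [set i] & nondescendents G i].
Proof. by rewrite disjoints1 !inE eqxx. Qed.

Lemma disjoint_parents i : [disjoint parents G i & nondescendents G i].
Proof.
rewrite -setI_eq0; apply/eqP/setP => j; rewrite !inE.
by case: (G j i); rewrite ?andbF.
Qed.

Lemma local_markov_implied (C E : {set 'I_n}) (K : finType) (blk : 'I_n -> K) :
  (forall i, nondescendents G i = set0 \/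
    [/\ [disjoint i |: parents G i :|: nondescendents G i & E],
        C \subset parents G i & blockwise C E blk (nondescendents G i)]) ->
  implied C E blk (local_markov G).
Proof.
move=> imp A1 A2 A3 /imsetP [i _ [-> -> ->]].
have [->|[dis sC bw]] := imp i; first by left.
by right; split; split=> //;
  [apply: disjointWl dis; rewrite -setUA subsetUl | apply: disjointWl dis; rewrite subsetUr
  |apply: disjointWl dis; rewrite -setUA setUCA subsetUl
  |exact: disjoint_nondescendents | exact: disjoint_parents].
Qed.

End LocalMarkov.

Section ThreeVertices.

Variables (G : rel 'I_3) (G_net : bayesian_network G).

Definition triple (i j k : 'I_3) : Prop :=
  [/\ i != j, i != k, j != k & forall x, [|| x == i, x == j | x == k]].

Lemma triple_ex i j : i != j -> exists k, triple i j k.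
Proof.
move=> ne_ij; have [k] : exists k, k \in ~: [set i; j].
  apply/set0Pn; rewrite -card_gt0; have := cardsC [set i; j].
  by rewrite cards2 ne_ij card_ord; case: #|~: _|.
rewrite !inE negb_or => /andP [ne_ki ne_kj]; exists k; split=> //.
- by rewrite eq_sym.
- by rewrite eq_sym.
move=> x; apply: contraT; rewrite !negb_or => /and3P [xi xj xk].
have: (size [:: x; i; j; k] <= #|'I_3|)%N.
  rewrite -(card_uniqP _) ?max_card //= !inE.
  by rewrite !negb_or xi xj xk ne_ij (eq_sym i) ne_ki (eq_sym j) ne_kj.
by rewrite card_ord.
Qed.

Lemma triple_swap i j k : triple i j k -> triple j i k.
Proof.
case=> ij ik jk cov; split=> //; first by rewrite eq_sym.
by move=> x; rewrite orbCA.
Qed.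

Lemma net_irrefl i : G i i = false.
Proof. by apply/negbTE; have := G_net (p := [:: i]); rewrite /= andbT; apply. Qed.

Lemma net_asym i j : G i j -> G j i = false.
Proof.
move=> Gij; apply/negbTE; have := G_net (p := [:: i; j]).
by rewrite /= Gij andbT; apply.
Qed.

(** A repetition-free path has at most three vertices. *)
Lemma connect_triple i j k : triple i j k ->
  connect G i j = G i j || (G i k && G k j).
Proof.
move=> [ij ik jk cov]; apply/idP/orP => [|[|/andP [Gik Gkj]]]; last first.
- exact: connect_trans (connect1 Gik) (connect1 Gkj).
- exact: connect1.
case/connectP => p0 /shortenP [p pth unq _] def_j.
have le_p : (size p <= 2)%N.
  by have := card_uniqP unq; have := max_card (mem (i :: p)); rewrite card_ord => + eq_c; rewrite eq_c.
case: p pth unq def_j le_p => [|x [|y [|//]]] /=.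
- by move=> _ _ eq_ji; rewrite eq_ji eqxx in ij.
- by rewrite andbT => Gix _ -> _; left.
rewrite andbT => /andP [Gix Gxy]; rewrite !inE negb_or => /and3P [/andP [ix _] xy _] eq_jy _.
right; move: (cov x); rewrite eq_sym (negbTE ix) /= eq_jy (negbTE xy) /= => /eqP <-.
by rewrite Gix.
Qed.

Lemma nondescendents_triple i j k : triple i j k ->
  (j \in nondescendents G i) = [&& ~~ G j i, ~~ G i j & ~~ (G i k && G k j)].
Proof.
move=> tr; rewrite !inE (connect_triple tr) negb_or.
by case: tr => ij _ _ _; rewrite eq_sym ij.
Qed.

Lemma triple_rot i j k : triple i j k -> triple i k j.
Proof.
case=> ij ik jk cov; split=> //; first by rewrite eq_sym.
by move=> x; rewrite [(x == k) || _]orbC.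
Qed.

Lemma tripleP i j k (A B : {set 'I_3}) : triple i j k ->
  (i \in A) = (i \in B) -> (j \in A) = (j \in B) -> (k \in A) = (k \in B) -> A = B.
Proof.
by case=> _ _ _ cov eqi eqj eqk; apply/setP => x; case/or3P: (cov x) => /eqP ->.
Qed.

Lemma nondescendents_self i : (i \in nondescendents G i) = false.
Proof. by rewrite !inE eqxx. Qed.

Lemma nondescendents_adjacent i j : G i j || G j i ->
  (j \in nondescendents G i) = false.
Proof.
rewrite !inE; case/orP=> [Gij|->]; last by rewrite andbF.
by rewrite (connect1 Gij) !andbF.
Qed.

End ThreeVertices.

Section Networks.
Variables (F : fieldType) (d : 'I_3 -> nat) (d_pos : forall i, (0 < d i)%N).
Variables (G : rel 'I_3) (G_net : bayesian_network G).

Local Notation I := (local_markov_ideal F d G).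

Lemma disjoint0 (A : {set 'I_3}) : [disjoint A & set0].
Proof. by rewrite -setI_eq0 setI0. Qed.

(** No vertex has a nondescendent, and the ideal is zero.  With C the set of all
vertices there is no block and the parametrization is injective. *)
Lemma complete_case : (forall i j, i != j -> G i j || G j i) -> prime_quadratic I.
Proof.
move=> adj; apply: (model_groebner d_pos (disjoint0 setT) ord0 (blk := id)).
  by move=> i; rewrite inE.
apply: local_markov_implied => i; left; apply/setP => j; rewrite in_set0.
have [->|ne_ij] := eqVneq i j; first exact: nondescendents_self.
exact: nondescendents_adjacent (adj _ _ ne_ij).
Qed.

Lemma isolated_nondescendents i : (forall j, G i j = false) ->
  (forall j, G j i = false) -> nondescendents G i = ~: [set i].
Proof.
move=> out inn; apply/setP => j; rewrite !inE inn /=.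
have [//|/= ne_ji] := eqVneq j i; apply/negP => /connectP [[|x p] /=].
  by move=> _ eq_ji; rewrite eq_ji eqxx in ne_ji.
by rewrite out.
Qed.

Lemma no_parents i : (forall j, G j i = false) -> parents G i = set0.
Proof. by move=> inn; apply/setP => j; rewrite !inE. Qed.

(** Complete independence: the blocks are singletons. *)
Lemma edgeless_case : (forall i j, G i j = false) -> prime_quadratic I.
Proof.
move=> no; apply: (model_groebner d_pos (disjoint0 set0) ord0 (blk := id)).
  move=> i _ _; exists [set i], (nondescendents G i); split.
  - by apply/imsetP; exists i; rewrite ?no_parents.
  - by rewrite isolated_nondescendents // setUCr setU0 setC0.
  - exact: disjoint_nondescendents.
  - by left; apply/setP => j; rewrite !inE.
apply: local_markov_implied => i; right; split; [exact: disjoint0 | exact: sub0set |].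
by move=> j j' nd_j _ _ /= <-.
Qed.

(** The blocks are {i} and {j, k}, the latter labelled by j.  The only
nondescendent of j and of k is i. *)
Lemma isolated_case i j k : triple i j k -> (forall x, G i x = false) ->
  (forall x, G x i = false) -> G j k || G k j -> prime_quadratic I.
Proof.
move=> tr out inn adj; pose blk x := if x == i then i else j.
apply: (model_groebner d_pos (disjoint0 set0) ord0 (blk := blk)).
  move=> x _ _; exists [set i], (nondescendents G i); split.
  - by apply/imsetP; exists i; rewrite ?no_parents.
  - by rewrite isolated_nondescendents // setUCr setU0 setC0.
  - exact: disjoint_nondescendents.
  have [ij _ _ _] := tr; have ji : (j == i) = false by rewrite eq_sym (negbTE ij).
  rewrite isolated_nondescendents //.
  have [->|ne_xi] := eqVneq x i; [left | right]; apply/setP => y.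
    by rewrite !inE /blk eqxx /=; case: (eqVneq y i); rewrite ?eqxx ?ji.
  rewrite !inE /blk (negbTE ne_xi) /=.
  by case: (eqVneq y i); rewrite ?eqxx // eq_sym ji.
apply: local_markov_implied => x; right; split; [exact: disjoint0 | exact: sub0set |].
move=> y z nd_y _ _; have [ij _ _ cov] := tr.
have [eq_xi|ne_xi] := eqVneq x i; rewrite /blk.
  move: nd_y; rewrite eq_xi isolated_nondescendents // !inE => /negbTE ->.
  by have [_ /eqP|//] := eqVneq z i; rewrite eq_sym (negbTE ij).
suff eq_yi : y = i.
  move: nd_y; rewrite eq_yi eqxx => nd_i; have [->//|_ /eqP] := eqVneq z i.
  by rewrite (negbTE ij).
apply: contraTeq nd_y => ne_yi; apply/negbT.
have [->|ne_yx] := eqVneq y x; first exact: nondescendents_self.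
apply: nondescendents_adjacent; move: (cov x) (cov y).
rewrite (negbTE ne_xi) (negbTE ne_yi) /= => /orP [] /eqP eq_x /orP [] /eqP eq_y.
- by rewrite eq_x eq_y eqxx in ne_yx.
- by rewrite eq_x eq_y.
- by rewrite eq_x eq_y orbC.
- by rewrite eq_x eq_y eqxx in ne_yx.
Qed.

Lemma nondescendents0 i j k : triple i j k ->
  (j \in nondescendents G i) = false -> (k \in nondescendents G i) = false ->
  nondescendents G i = set0.
Proof.
move=> tr ndj ndk.
by apply: (tripleP tr); rewrite in_set0 ?nondescendents_self.
Qed.

(** As k is a parent of i, the vertex i contributes the statement that i and j are
independent given k.  The vertex j contributes the same statement if k is its
parent, and none if i is its descendent. *)
Lemma chain_case i j k : triple i j k -> G i j = false -> G j i = false ->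
  G k i -> G j k || G k j -> prime_quadratic I.
Proof.
move=> tr Gij Gji Gki adj; have Gik := net_asym G_net Gki.
have [/negbTE ij /negbTE ik /negbTE jk cov] := tr.
have pa_i : parents G i = [set k].
  by apply: (tripleP tr); rewrite !inE ?(net_irrefl G_net) ?Gji ?Gki ?ik ?jk ?eqxx.
have nd_i : nondescendents G i = [set j].
  apply: (tripleP tr).
  - by rewrite nondescendents_self inE ij.
  - by rewrite (nondescendents_triple G tr) Gij Gji Gik inE eqxx.
  - by rewrite nondescendents_adjacent ?Gki ?orbT // inE eq_sym jk.
apply: (model_groebner d_pos (disjoint0 [set k]) ord0 (blk := id)).
  move=> x; rewrite inE => /negbTE xk _; exists [set i], (nondescendents G i); split.
  - by apply/imsetP; exists i; rewrite ?pa_i.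
  - rewrite nd_i; apply/setP => y; rewrite setC0 [RHS]inE; have := cov y.
    by rewrite !inE orbA.
  - exact: disjoint_nondescendents.
  by rewrite block_id ?inE ?xk // nd_i; move: (cov x); rewrite xk orbF;
    case/orP=> /eqP ->; [left | right].
apply: local_markov_implied => x.
have bw y : blockwise [set k] set0 id (nondescendents G y).
  by move=> z z' nd_z _ _ /= <-.
case/or3P: (cov x) => /eqP ->.
- by right; rewrite pa_i; split; first exact: disjoint0.
- have [Gkj|nGkj] := boolP (G k j).
    right; split=> //; first exact: disjoint0.
    by apply/fintype.subsetP => y; rewrite !inE => /eqP ->.
  left; have tr' := triple_swap tr; apply: (nondescendents0 tr').
    rewrite (nondescendents_triple G tr') Gki.
    by move: adj; rewrite (negbTE nGkj) orbF => ->; rewrite !andbF.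
  exact: nondescendents_adjacent.
left; apply: (nondescendents0 (triple_swap (triple_rot tr))).
  by apply: nondescendents_adjacent; rewrite Gki.
by apply: nondescendents_adjacent; rewrite orbC.
Qed.

Lemma collider_local i j k : triple i j k -> G i j = false -> G j i = false ->
  G i k -> G j k -> parents G i = set0 /\ nondescendents G i = [set j].
Proof.
move=> tr Gij Gji Gik Gjk; have [/negbTE ij _ /negbTE jk _] := tr.
have Gki := net_asym G_net Gik; have Gkj := net_asym G_net Gjk.
split; apply: (tripleP tr).
- by rewrite !inE (net_irrefl G_net).
- by rewrite !inE.
- by rewrite !inE.
- by rewrite nondescendents_self inE ij.
- by rewrite (nondescendents_triple G tr) Gij Gji Gkj andbF inE eqxx.
- by rewrite nondescendents_adjacent ?Gik // inE eq_sym jk.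
Qed.

(** The statement is that i and j are independent; the common child k is summed
out. *)
Lemma collider_case i j k : triple i j k -> G i j = false -> G j i = false ->
  G i k -> G j k -> prime_quadratic I.
Proof.
move=> tr Gij Gji Gik Gjk.
have [/negbTE ij /negbTE ik /negbTE jk cov] := tr.
have [pa_i nd_i] := collider_local tr Gij Gji Gik Gjk.
have [pa_j nd_j] := collider_local (triple_swap tr) Gji Gij Gjk Gik.
have dis0 : [disjoint set0 & [set k]] by rewrite -setI_eq0 set0I.
apply: (model_groebner d_pos dis0 ord0 (blk := id)).
  move=> x _; rewrite inE => /negbTE xk; exists [set i], (nondescendents G i); split.
  - by apply/imsetP; exists i; rewrite ?pa_i.
  - by rewrite nd_i; apply: (tripleP tr); rewrite !inE ?eqxx ?(eq_sym k) ?ij ?ik ?jk ?orbT.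
  - exact: disjoint_nondescendents.
  by rewrite block_id ?inE ?xk // nd_i; move: (cov x); rewrite xk orbF;
    case/orP=> /eqP ->; [left | right].
have disE (A : {set 'I_3}) : k \notin A -> [disjoint A & [set k]].
  by rewrite disjoint_sym disjoints1.
have bw (A : {set 'I_3}) : blockwise set0 [set k] id A by move=> z z' Az _ _ /= <-.
apply: local_markov_implied => x; case/or3P: (cov x) => /eqP ->.
- right; split=> //; last by rewrite sub0set.
  by rewrite pa_i nd_i; apply: disE; rewrite !inE ![k == _]eq_sym ik jk.
- right; split=> //; last by rewrite sub0set.
  by rewrite pa_j nd_j; apply: disE; rewrite !inE ![k == _]eq_sym ik jk.
left; apply: (nondescendents0 (triple_swap (triple_rot tr)));
  by apply: nondescendents_adjacent; rewrite ?Gik ?Gjk orbT.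
Qed.

(** The cases are distinguished by the edges at the third vertex; when k has an
edge to only one of i and j, the other one is isolated. *)
Lemma nonadjacent_case i j : i != j -> G i j = false -> G j i = false ->
  prime_quadratic I.
Proof.
move=> ne_ij Gij Gji; have [k tr] := triple_ex ne_ij.
have tr' := triple_swap tr; have [_ _ _ cov] := tr.
have irr := net_irrefl G_net.
have all3 (P : 'I_3 -> Prop) : P i -> P j -> P k -> forall x, P x.
  by move=> Pi Pj Pk x; case/or3P: (cov x) => /eqP ->.
have [Gki|/negbTE Gki] := boolP (G k i).
  have [adj|] := boolP (G j k || G k j); first exact: chain_case tr _ _ _ _.
  rewrite negb_or => /andP [/negbTE Gjk /negbTE Gkj].
  apply: (isolated_case tr'); [exact: all3 | exact: all3 | by rewrite Gki orbT].
have [Gkj|/negbTE Gkj] := boolP (G k j).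
  have [Gik|/negbTE Gik] := boolP (G i k).
    by apply: (chain_case tr') => //; rewrite Gik.
  apply: (isolated_case tr); [exact: all3 | exact: all3 | by rewrite Gkj orbT].
have [Gik|/negbTE Gik] := boolP (G i k); have [Gjk|/negbTE Gjk] := boolP (G j k).
- exact: collider_case tr _ _ _ _.
- by apply: (isolated_case tr'); [exact: all3 | exact: all3 | rewrite Gik].
- by apply: (isolated_case tr); [exact: all3 | exact: all3 | rewrite Gjk].
by apply: edgeless_case; apply: (all3); apply: (all3).
Qed.

Lemma three_vertex_network : prime_quadratic I.
Proof.
have [/existsP [i /existsP [j /and3P [ne_ij Gij Gji]]]|/existsPn adj] :=
    boolP [exists i, exists j, [&& i != j, ~~ G i j & ~~ G j i]].
  by apply: (@nonadjacent_case i j) => //; exact/negbTE.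
apply: complete_case => i j ne_ij; have /existsPn/(_ j) := adj i.
by rewrite ne_ij /= -negb_or negbK.
Qed.

End Networks.

Theorem proposition5 (R : realType) (d : 'I_3 -> nat) (G : rel 'I_3)
    (d_pos : forall i, (0 < d i)%N) (G_net : bayesian_network G) :
  prime_ideal (local_markov_ideal R d G) /\
  exists (le : rel 'X_{1..#|outcome d|}) (gs : seq (prob_ring R d)),
    [/\ term_order le,
        groebner_basis le gs (local_markov_ideal R d G) &
        forall g, g \in gs -> quadratic g].
Proof. exact: (three_vertex_network R d_pos G_net). Qed.
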